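(* Let $u:(\mathbb T^3)^2\to\mathbb R$ be even, i.e. $u(-p,-q)=u(p,q)$, have a unique minimum, located at $(0,0)$ and non-degenerate, and have all third order partial derivatives continuous on $(\mathbb T^3)^2$ with restrictions to $(U_\delta(0))^2$ belonging to $\mathcal B(\theta,(U_\delta(0))^2)$. Suppose there are a positive definite $3\times3$ matrix $U$ and real numbers $l_1,l_2>0$, $l\neq 0$ with $$\Big(\tfrac{\partial^2u(0,0)}{\partial p^{(i)}\partial p^{(j)}}\Big)_{i,j=1}^3=l_1U,\quad \Big(\tfrac{\partial^2u(0,0)}{\partial p^{(i)}\partial q^{(j)}}\Big)_{i,j=1}^3=lU,\quad \Big(\tfrac{\partial^2u(0,0)}{\partial q^{(i)}\partial q^{(j)}}\Big)_{i,j=1}^3=l_2U .$$ Let $\varphi:\mathbb T^3\to\mathbb R$ be continuous, either even or odd, with all second order partial derivatives continuous on $\mathbb T^3$. Assume further: (a) $\Lambda(p,u_{\min}(p))-\Lambda(0,u_{\min}(0))>0$ for all $0\neq p\in\mathbb T^3$; (b) the function $\Lambda(\cdot,m)$ has a unique maximum on $\mathbb T^3$, located at the origin, and for some $c>0$ one has $\Lambda(0,m)-\Lambda(p,m)>c|p|^2$ for all $0\neq p\in U_\delta(0)$. Let $\mu_0=\Lambda(0,m)^{-1}$. Then: (i) For every $p\in\mathbb T^3\setminus\{0\}$ the operator $h_{\mu_0}(p)$ has a unique eigenvalue $e_{\mu_0}(p)$ below $u_{\min}(p)$ (the bottom of its essential spectrum), and $$m<e_{\mu_0}(p)<u_{\min}(p),\qquad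 0\neq p\in\mathbb T^3 .$$ (ii) For every $\mu>\mu_0$ and every $p\in\mathbb T^3$ the operator $h_\mu(p)$ has a unique eigenvalue $e_\mu(p)$ below $u_{\min}(p)$, and $$e_\mu(p)<e_{\mu_0}(p)<u_{\min}(p),\quad 0\neq p\in\mathbb T^3,\qquad\text{and}\qquad e_\mu(0)<m .$$
   Context: $\mathbb T^3$ is the three-dimensional torus, i.e. $(-\pi,\pi]^3$ with opposite faces identified. $U_\delta(0)=\{p\in\mathbb T^3:|p|<\delta\}$ with $\delta>0$ sufficiently small. $\theta$ is a fixed number with $1/2<\theta<1$, and $\mathcal B(\theta,\Omega)$ denotes the Banach space of Hölder continuous functions on $\overline\Omega$ with exponent $\theta$ obtained as the closure of the smooth functions on $\Omega$ in the norm $\|f\|_\theta=\sup_{t\neq\ell\in\Omega}\big[|f(t)|+|t-\ell|^{-\theta}|f(t)-f(\ell)|\big]$. Non-degenerate minimum means that the Hessian there is positive definite. For $\mu>0$ and $p\in\mathbb T^3$, $h_\mu(p)$ is the bounded self-adjoint operator on $L_2(\mathbb T^3)$ $$(h_\mu(p)f)(q)=u(p,q)f(q)-\mu\,\varphi(q)\int_{\mathbb T^3}\varphi(t)f(t)\,dt ,$$ where the multiplication operator $h_0(p)$ is understood as multiplication by $u_p(q)$, with $u_p(q)=u(p,q)$. Set $m=\min_{p,q\in\mathbb T^3}u(p,q)$ and $u_{\min}(p)=\min_{q\in\mathbb T^3}u_p(q)$. For real $z<u_{\min}(p)$, $$\Lambda(p,z)=\int_{\mathbb T^3}\frac{\varphi^2(t)\,dt}{u_p(t)-z},$$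 and $\Lambda(p,u_{\min}(p))=\lim_{z\to u_{\min}(p)-0}\Lambda(p,z)$, a finite or infinite limit. Note $u_{\min}(0)=m$. *)

(* Defs.v *)
From HB Require Import structures.
From mathcomp Require Import all_boot all_order all_algebra.
From mathcomp Require Import all_classical all_reals all_analysis.
From mathcomp Require Import complex.

Set Implicit Arguments.
Unset Strict Implicit.
Unset Printing Implicit Defensive.

Import Order.TTheory GRing.Theory Num.Theory.
Import numFieldNormedType.Exports.

Local Open Scope classical_set_scope.
Local Open Scope ring_scope.
Local Open Scope complex_scope.

Definition posdef (R : realType) (n : nat) (A : 'M[R]_n) : Prop :=
  A^T = A /\ forall x : 'cV[R]_n, x != 0 -> 0 < (x^T *m A *m x) 0 0.

Section PartialDerivatives.
Context (R : realType) (V : normedModType R) (I : Type) (e : I -> V).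

Definition torus_periodic (f : V -> R) : Prop :=
  forall (i : I) (x : V), f (x + (2 * pi) *: e i) = f x.

Definition pderiv (s : seq I) (f : V -> R) : V -> R :=
  foldr (fun i g => 'D_(e i) g) f s.

(* s lists the directions of an iterated partial derivative of order size s *)
Definition Ck_on (k : nat) (O : set V) (f : V -> R) : Prop :=
  forall s : seq I,
    ((size s < k)%N ->
      forall (i : I) (x : V), O x -> derivable (pderiv s f) x (e i)) /\
    ((size s <= k)%N ->
      forall x : V, O x -> {for x, continuous (pderiv s f)}).

Definition smooth_on (O : set V) (f : V -> R) : Prop :=
  forall k : nat, Ck_on k O f.

Section Hoelder.
Variables (nrm : V -> R) (theta : R) (O : set V).

Definition hoelder_norm (f : V -> R) : \bar R :=
  ereal_sup [set y | exists s t : V, [/\ O s, O t, s != t &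
    y = (`|f s| + (nrm (s - t)) `^ (- theta) * `|f s - f t|)%:E]].

(* The closure of the smooth functions on O (of finite norm) for
   hoelder_norm; only the values of f on O matter. *)
Definition hoelder_space (f : V -> R) : Prop :=
  forall eps : R, 0 < eps -> exists g : V -> R,
    [/\ smooth_on O g, (hoelder_norm g < +oo)%E &
        (hoelder_norm (fun x => (f x - g x)%R) < eps%:E)%E].
End Hoelder.

End PartialDerivatives.

(* A function on the torus is a function on R^3 that is 2pi-periodic in every
   coordinate; a point of the torus is its representative in (-pi, pi]^3. *)
Section Torus.
Context (R : realType).
Local Notation R3 := (R * R * R)%type.

Definition torus : set R3 :=
  [set` `]-pi, pi]] `*` [set` `]-pi, pi]] `*` [set` `]-pi, pi]].

Definition e3 (i : 'I_3) : R3 :=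
  ((i == 0%N :> nat)%:R, (i == 1%N :> nat)%:R, (i == 2%N :> nat)%:R).

Definition e33 (k : 'I_3 + 'I_3) : R3 * R3 :=
  match k with inl i => (e3 i, 0) | inr j => (0, e3 j) end.

Definition enorm3 (x : R3) : R :=
  Num.sqrt (x.1.1 ^+ 2 + x.1.2 ^+ 2 + x.2 ^+ 2).

Definition enorm33 (w : R3 * R3) : R :=
  Num.sqrt (enorm3 w.1 ^+ 2 + enorm3 w.2 ^+ 2).

Definition ball_torus (delta : R) : set R3 :=
  [set p | torus p /\ enorm3 p < delta].

(* second derivatives d^2 u / dx_i dy_j at the origin, where x and y are each
   one of the two arguments of u, selected by a and b *)
Definition hess_block (a b : 'I_3 -> 'I_3 + 'I_3) (u : R3 * R3 -> R) : 'M[R]_3 :=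
  \matrix_(i, j) pderiv e33 [:: a i; b j] u 0.

Definition hess (u : R3 * R3 -> R) : 'M[R]_(3 + 3) :=
  block_mx (hess_block inl inl u) (hess_block inl inr u)
           (hess_block inr inl u) (hess_block inr inr u).

End Torus.

Notation leb3 R :=
  (@lebesgue_measure R \x @lebesgue_measure R \x @lebesgue_measure R)%E.

(* The complex Hilbert space L_2(T^3) is handled through representatives:
   equality in it is ae_eq on the torus. *)
Section L2.
Context (R : realType).
Local Notation R3 := (R * R * R)%type.
Implicit Types (f : R3 -> R[i]) (H : (R3 -> R[i]) -> (R3 -> R[i])).

Definition L2_eq (f g : R3 -> R[i]) : Prop := ae_eq (leb3 R) (@torus R) f g.

Definition L2_normsq f : \bar R :=
  (\int[leb3 R]_(t in @torus R) (complex.Re (f t) ^+ 2 + complex.Im (f t) ^+ 2)%:E)%E.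

Definition L2 f : Prop :=
  [/\ measurable_fun (@torus R) (fun t => complex.Re (f t)),
      measurable_fun (@torus R) (fun t => complex.Im (f t)) &
      (L2_normsq f < +oo)%E].

Definition cintegral f : R[i] :=
  (\int[leb3 R]_(t in @torus R) complex.Re (f t)) +i*
  (\int[leb3 R]_(t in @torus R) complex.Im (f t)).

Definition eigenfunction H (z : R) f : Prop :=
  L2 f /\ L2_eq (H f) (fun q => z%:C * f q).

Definition eigenvalue_of H (z : R) : Prop :=
  exists f, eigenfunction H z f /\ ~ L2_eq f (fun=> 0).

Definition finite_multiplicity H (z : R) : Prop :=
  exists (n : nat) (g : 'I_n -> R3 -> R[i]), (forall k, L2 (g k)) /\
    forall f, eigenfunction H z f ->
      exists c : 'I_n -> R[i], L2_eq f (fun q => \sum_(k < n) c k * g k q).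

(* H - z is onto with a bounded inverse. *)
Definition in_resolvent_set H (z : R) : Prop :=
  (exists2 C : R, 0 < C & forall f, L2 f ->
    (L2_normsq f <= C%:E * L2_normsq (fun q => (H f q - z%:C * f q)%R))%E) /\
  (forall g, L2 g -> exists2 f, L2 f & L2_eq (fun q => H f q - z%:C * f q) g).

(* Only real spectral points are considered: the operators of interest are
   self-adjoint, so their spectra are real. *)
Definition spectrum H : set R := [set z | ~ in_resolvent_set H z].

Definition discrete_spectrum H : set R :=
  [set z | [/\ eigenvalue_of H z, finite_multiplicity H z &
    exists2 eps : R, 0 < eps &
      forall z', spectrum H z' -> `|z' - z| < eps -> z' = z]].

Definition essential_spectrum H : set R := spectrum H `\` discrete_spectrum H.

Definition is_bottom (S : set R) (b : R) : Prop := S b /\ lbound S b.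

End L2.

Section Model.
Context (R : realType).
Local Notation R3 := (R * R * R)%type.
Variables (u : R3 * R3 -> R) (phi : R3 -> R).

Definition hop (mu : R) (p : R3) (f : R3 -> R[i]) : R3 -> R[i] :=
  fun q => (u (p, q))%:C * f q -
           (mu * phi q)%:C * cintegral (fun t => (phi t)%:C * f t).

(* For a continuous periodic u these infima are minima. *)
Definition u_inf : R := inf (u @` (@torus R `*` @torus R)).

Definition u_min (p : R3) : R := inf ((fun q => u (p, q)) @` @torus R).

Definition Lambda_int (p : R3) (z : R) : \bar R :=
  (\int[leb3 R]_(t in @torus R) (phi t ^+ 2 / (u (p, t) - z))%:E)%E.

(* Meaningful for z <= u_min p only: at z = u_min p it is the limit from the
   left, finite or infinite. *)
Definition Lambda (p : R3) (z : R) : \bar R :=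
  if z < u_min p then Lambda_int p z
  else lim (Lambda_int p z' @[z' --> z^'-]).

Definition unique_eigenvalue_below (mu : R) (p : R3) (e : R) : Prop :=
  [/\ e < u_min p, eigenvalue_of (hop mu p) e &
      forall z, z < u_min p -> eigenvalue_of (hop mu p) z -> z = e].

End Model.

(* Main.v *)
Require Import Defs.
From HB Require Import structures.
From mathcomp Require Import all_boot all_order all_algebra.
From mathcomp Require Import all_classical all_reals all_analysis.
From mathcomp Require Import measurable_realfun.
From mathcomp Require Import complex ring lra.

Set Implicit Arguments.
Unset Strict Implicit.
Unset Printing Implicit Defensive.

Import Order.TTheory GRing.Theory Num.Theory.
Import numFieldNormedType.Exports.

Local Open Scope classical_set_scope.
Local Open Scope ring_scope.

(** For z below the minimum u_min p of u_p the equation h_mu(p) f = z f reads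
    f = mu (phi, f) phi / (u_p - z), so that z is an eigenvalue exactly when
    mu * Lambda(p, z) = 1 ([hop_eigenvalue_secular], [hop_secular_eigenvalue]).
    On the half-line z < u_min p, the function Lambda(p, .) is continuous,
    increases strictly where it is positive and tends to 0 at -oo; there is
    therefore one solution as soon as 1 / mu lies below the limit
    Lambda(p, u_min p) ([hop_unique_eigenvalue]), and a larger mu moves it to
    the left ([hop_eigenvalue_decreasing]).

    Put b = Lambda(0, m) = 1 / mu_0. Hypothesis (a) forces b to be finite,
    because the difference x - (+oo) is -oo for every extended real x, and it
    says that b < Lambda(p, u_min p) for p <> 0, which gives existence for
    mu_0. Hypothesis (b) says that 0 <= Lambda(p, m) < b for p <> 0; hence mu_0
    is positive and, as m < u_min p, the eigenvalue for mu_0 has to lie to the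
    right of m ([hop_eigenvalue_gt]). When mu > mu_0 the level 1 / mu is below b, and
    existence holds at p = 0 too, where u_min 0 = m.

    All the properties of Lambda(p, .) come from one pair of inequalities: if
    e <= u_p <= M and z < z' < e, then
      (e - z') / (e - z) * Lambda(p, z') <= Lambda(p, z)
                          <= (M - z') / (M - z) * Lambda(p, z'),
    since (u_p - z') / (u_p - z) is an increasing function of the value of u_p
    ([secular_lower], [secular_upper]).

    The bottom of the essential spectrum is u_min p ([hop_essential_bottom]).
    Below u_min p, the resolvent is explicit when mu * Lambda(p, z) <> 1, and a
    solution of mu * Lambda(p, z) = 1 is an isolated eigenvalue of multiplicity
    one. On the other hand every value u_p(q) belongs to the spectrum: step
    functions orthogonal to phi and carried by a small neighbourhood of q are
    approximate eigenvectors ([hop_spectrum_range]). If u_min p were isolated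
    in the spectrum, u_p would therefore be equal to u_min p on a whole
    neighbourhood of its minimum point, and then the same step functions are
    infinitely many independent eigenvectors
    ([flat_bottom_infinite_multiplicity]).

    As phi and u_p are real, the operator acts separately on real and imaginary
    parts, and the analysis is done on real functions, over an arbitrary
    measurable set of finite measure ([rank_one]). *)

(** * Increasing functions with two-sided ratio bounds *)

(** [L] stands for Lambda(p, .), and [d], [M] for the bounds of u_p. The
    ratio bounds carry the monotonicity, the continuity and the decay at -oo. *)
Section SecularFunction.
Context (R : realType) (L : R -> R) (d M : R).
Hypothesis dM : d <= M.
Hypothesis L_ge0 : forall z, z < d -> 0 <= L z.
Hypothesis L_lower : forall z z', z < z' -> z' < d ->
  (d - z') / (d - z) * L z' <= L z.
Hypothesis L_upper : forall z z', z < z' -> z' < d ->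
  L z <= (M - z') / (M - z) * L z'.

Lemma secular_lt z z' : z < z' -> z' < d -> 0 < L z' -> L z < L z'.
Proof.
move=> zz' z'd Lz'; apply: (le_lt_trans (L_upper zz' z'd)).
by have dM' := dM; rewrite gtr_pMl// ltr_pdivrMr; lra.
Qed.

Lemma secular_le z z' : z <= z' -> z' < d -> L z <= L z'.
Proof.
rewrite le_eqVlt => /predU1P[->//|zz'] z'd.
apply: (le_trans (L_upper zz' z'd)).
by have dM' := dM; rewrite ler_piMl ?L_ge0// ler_pdivrMr; lra.
Qed.

(** The factor (M - z') / (M - z) of the upper bound tends to 0 at -oo. *)
Lemma secular_small c : 0 < c -> exists2 a, a < d & L a < c.
Proof.
have dM' := dM; move=> c0.
have [Ld|Ld] := ltP (L (d - 1)) c; first by exists (d - 1) => //; lra.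
set A := L (d - 1) in Ld.
(* chosen so that (M - (d - 1)) * A < c * (M - a) *)
set a := d - 1 - (M - d + 1) * A / c.
have A0 : 0 < A by lra.
have ha : a < d - 1.
  by rewrite /a gtrDl oppr_lt0 divr_gt0// mulr_gt0//; lra.
exists a; first lra.
have d1 : d - 1 < d by lra.
have := L_upper ha d1; rewrite -/A => /le_lt_trans; apply.
rewrite mulrAC ltr_pdivrMr; last by lra.
have -> : c * (M - a) = c * (M - d + 1) + (M - d + 1) * A.
  by rewrite /a; field; lra.
rewrite opprB addrA -addrAC.
have : 0 < c * (M - d + 1) by rewrite mulr_gt0//; lra.
lra.
Qed.

(** The lower ratio bound makes [L] Lipschitz on every segment [a, b] with
    b < d. *)
Lemma secular_continuous a b : a < b -> b < d -> {within `[a, b], continuous L}.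
Proof.
move=> ab bd.
set K := L b / (d - b).
have K0 : 0 <= K by rewrite divr_ge0 ?L_ge0//; lra.
have lip x y : x < y -> y <= b -> `|L x - L y| <= K * (y - x).
  move=> xy yb; have yd : y < d by lra.
  rewrite distrC ger0_norm; last by rewrite subr_ge0 secular_le// ltW.
  have := L_lower xy yd; have Lyb := secular_le yb bd.
  have -> : (d - y) / (d - x) = 1 - (y - x) / (d - x) by field; lra.
  move=> H; have : L y - L x <= (y - x) / (d - x) * L y by lra.
  move=> /le_trans; apply.
  rewrite /K [leRHS]mulrC -mulrA ler_wpM2l//; first by lra.
  rewrite mulrC ler_pM ?invr_ge0 ?L_ge0//; first lra.
  by rewrite lef_pV2 ?posrE; lra.
have lip2 x y : x <= b -> y <= b -> `|L x - L y| <= K * `|x - y|.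
  move=> xb yb; have [xy|xy|->] := ltgtP x y;
    last by rewrite !subrr normr0 mulr0.
    by rewrite [`|x - y|]distrC (@gtr0_norm _ (y - x)) ?subr_gt0// lip.
  by rewrite distrC (@gtr0_norm _ (x - y)) ?subr_gt0// lip.
rewrite continuous_subspace_in => x xab; apply/cvgrPdist_le => e e0.
rewrite /= /nbhs/= -(nbhs_subspace_in (set_mem xab)).
have : \forall y \near x, `|x - y| <= e / (K + 1).
  have r0 : 0 < e / (K + 1) by rewrite divr_gt0//; lra.
  by apply: filterS (nbhsx_ballx x _ r0) => y /ltW.
apply: filterS => y xye yab.
move: xab yab; rewrite inE/= !in_itv/= => /andP[_ xb] /andP[_ yb].
apply: (le_trans (lip2 _ _ xb yb)).
move: xye; rewrite ler_pdivlMr; last lra.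
by have := normr_ge0 (x - y); nra.
Qed.

Lemma secular_root a b c : a < d -> b < d -> 0 < c -> L a < c -> c < L b ->
  exists2 e, a < e < d & L e = c.
Proof.
move=> ad bd c0 Lac cLb.
have ab : a < b.
  by rewrite ltNge; apply/negP => ba; have := secular_le ba ad; lra.
have [|e] := IVT (ltW ab) (secular_continuous ab bd) (v := c).
  have Lab : L a <= L b by lra.
  by rewrite (min_idPl Lab) (max_idPr Lab) !ltW.
rewrite in_itv/= => /andP[ae eb] Le; exists e => //.
rewrite (le_lt_trans eb bd) andbT lt_neqAle ae andbT.
by apply/eqP => aE; move: Lac; rewrite aE Le ltxx.
Qed.

Lemma secular_inj z z' : z < d -> z' < d -> 0 < L z -> L z = L z' -> z = z'.
Proof.
move=> zd z'd Lz Lzz'; have [h|h|//] := ltgtP z z'.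
  by have := secular_lt h z'd; rewrite -Lzz' ltxx => /(_ Lz).
by have := secular_lt h zd Lz; rewrite Lzz' ltxx.
Qed.

(** Used by contraposition: a level below the limit at [d] is exceeded at some
    z < d. The function [F] is extended-real valued and is only constrained on
    the left of [d], as is the integral that defines Lambda. *)
Lemma secular_lim_le (F : R -> \bar R) c :
  (forall z, z < d -> F z = (L z)%:E) -> (forall z, z < d -> L z <= c) ->
  (lim (F z @[z --> d^'-]) <= c%:E)%E.
Proof.
move=> FL Lc.
have cvL : cvg (L z @[z --> d^'-]).
  apply: nondecreasing_at_left_is_cvgr.
    near=> x => y z; rewrite !in_itv/= => /andP[_ yd] /andP[_ zd] yz.
    exact: secular_le.
  near=> x; exists c => _ [y + <-]; rewrite /= in_itv/= => /andP[_ yd].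
  exact: Lc.
have cvF : cvg (F z @[z --> d^'-]).
  apply/cvg_ex; exists (lim (L z @[z --> d^'-]))%:E; apply: cvg_EFin.
    by near=> z; rewrite FL//; near: z; exact: nbhs_left_lt.
  apply: cvg_trans cvL; apply: near_eq_cvg.
  by near=> z; rewrite /= FL//; near: z; exact: nbhs_left_lt.
apply: lime_le => //; near=> z.
have zd : z < d by near: z; exact: nbhs_left_lt.
by rewrite FL// lee_fin Lc.
Unshelve. all: by end_near. Qed.

End SecularFunction.

(** * Continuous functions on the torus *)

Section TorusTopology.
Context (R : realType).
Local Notation R3 := (R * R * R)%type.
(* R^3 with the measurable structure that carries the product measure *)
Local Notation mR3 :=
  (measurableTypeR R * measurableTypeR R * measurableTypeR R)%type.

(** An open set is a countable union of cubes with rational centre and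
    radius. *)
Lemma open3_measurable (A : set R3) : open A -> measurable A.
Proof.
move=> oA.
pose box (q : rat * rat * rat * rat) : set R3 :=
  ball (ratr q.1.1.1 : R) (ratr q.2) `*` ball (ratr q.1.1.2 : R) (ratr q.2)
    `*` ball (ratr q.1.2 : R) (ratr q.2).
have -> : A = \bigcup_q (if `[< box q `<=` A >] then box q else set0).
  apply/seteqP; split => [[[x y] z] Axyz|x [q _]]; last first.
    by case: ifPn => // /asboolP; apply.
  have /nbhs_ballP[_/posnumP[e] eA] : nbhs (x, y, z) A by exact: open_nbhs_nbhs.
  have e2 : 0 < e%:num / 2 by [].
  have [r] := rat_in_itvoo e2; rewrite in_itv/= => /andP[r0 re].
  have approx (t : R) : exists s : rat, `|ratr s - t| < ratr r.
    have tr : t - ratr r < t + ratr r by lra.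
    have [s] := rat_in_itvoo tr; rewrite in_itv/= => /andP[s1 s2].
    by exists s; rewrite ltr_norml; apply/andP; split; lra.
  have [a ax] := approx x; have [b bx] := approx y; have [c cx] := approx z.
  exists (a, b, c, r) => //; case: ifPn => [_|/asboolPn[]]; first by [].
  move=> [[x' y'] z'] [[/= ax' by'] cz']; apply: eA.
  rewrite /ball/= /prod_ball/= /ball/= in ax' by' cz' *.
  have dist (s t t' : R) : `|s - t| < ratr r -> `|s - t'| < ratr r ->
      `|t - t'| < e%:num.
    by rewrite !ltr_norml => /andP[? ?] /andP[? ?]; apply/andP; split; lra.
  by split; [split|]; apply: dist; eassumption.
apply: countable_bigcupT_measurable => [//|q].
case: ifPn => _; last exact: measurable0.
by apply: measurableX; [apply: measurableX|];
  apply: open_measurable; apply: ball_open.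
Qed.

Lemma continuous3_measurable (D : set mR3) (f : R3 -> R) : measurable D ->
  continuous f -> measurable_fun D (f : mR3 -> R).
Proof.
move=> mD cf; apply: measurable_funTS.
apply: (measurability _ (RGenOpens.measurableE R)).
move=> _ [_ [a [b ->] <-]]; rewrite setTI; apply: open3_measurable.
by move/continuousP: cf; apply; exact: interval_open.
Qed.

Lemma measurable_torus : measurable (@torus R : set mR3).
Proof.
by apply: measurableX; [apply: measurableX|]; apply: measurable_itv.
Qed.

Lemma leb3_box (a b c a' b' c' : R) : a < a' -> b < b' -> c < c' ->
  leb3 R ([set` `]a, a']] `*` [set` `]b, b']] `*` [set` `]c, c']]) =
  ((a' - a) * (b' - b) * (c' - c))%:E.
Proof.
move=> aa' bb' cc'.
pose m := @lebesgue_measure R.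
have mitv (x x' : R) : measurable ([set` `]x, x']] : set R).
  exact: measurable_itv.
rewrite (product_measure1E (m \x m)%E m
  (measurableX (mitv a a') (mitv b b')) (mitv c c')).
rewrite [X in (X * _)%E](product_measure1E m m (mitv a a') (mitv b b')).
have len (x x' : R) : x < x' -> m [set` `]x, x']] = (x' - x)%:E.
  by move=> xx'; rewrite /m lebesgue_measure_itv/= lte_fin xx'.
by rewrite !EFinM -!len.
Qed.

Lemma leb3_torus : (leb3 R (@torus R) < +oo)%E.
Proof. by rewrite leb3_box ?ltry//; have := pi_gt0 R; lra. Qed.

(** The half-open boxes with upper corner at [q] stay inside (-pi, pi]^3, even
    when [q] lies on the boundary; slicing one of them along the first
    coordinate gives as many disjoint pieces as wanted. *)
Lemma torus_disjoint_boxes (q : R3) (O : set R3) (n : nat) :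
  torus q -> nbhs q O -> exists A : 'I_n -> set R3,
  (forall i, [/\ measurable (A i : set mR3), A i `<=` @torus R `&` O &
                 (0 < leb3 R (A i))%E]) /\
  (forall i j x, A i x -> A j x -> i = j).
Proof.
case: q => [[a b] c] [[/= ta tb] tc] /nbhs_ballP[_/posnumP[r] rO].
rewrite /= !in_itv/= in ta tb tc.
case/andP: ta => a1 a2; case/andP: tb => b1 b2; case/andP: tc => c1 c2.
pose h := Num.min r%:num (Num.min (a + pi) (Num.min (b + pi) (c + pi))).
have h0 : 0 < h by rewrite !lt_min; apply/and4P; split => //; lra.
have : h <= h by []; rewrite {2}/h !le_min => /and4P[hr ha hb hc].
pose k := h / n.+1%:R.
have k0 : 0 < k by rewrite divr_gt0.
have kn (i : 'I_n) : k * i.+1%:R <= h.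
  rewrite /k mulrAC ler_pdivrMr// ler_pM2l// ler_nat.
  by rewrite (leq_trans (ltn_ord i)).
have kS (i : nat) : k * i.+1%:R = k * i%:R + k by rewrite -natr1 mulrDr mulr1.
have ki (i : nat) : 0 <= k * i%:R by rewrite mulr_ge0// ltW.
exists (fun i => [set` `]a - k * i.+1%:R, a - k * i%:R]] `*`
  [set` `]b - h, b]] `*` [set` `]c - h, c]]).
split=> [i|i j [[x y] z]].
  split.
  - by apply: measurableX; [apply: measurableX|].
  - move=> [[x y] z] [[/=]]; rewrite !in_itv/=.
    move=> /andP[x1 x2] /andP[y1 y2] /andP[z1 z2].
    have := kn i; have := ki i => ki' kn'.
    split.
      by split; [split|]; rewrite /= in_itv/=; apply/andP; split; lra.
    apply: rO; rewrite /ball/= /prod_ball/= /ball/=.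
    by split; [split|]; rewrite /ball/= ltr_norml; apply/andP; split; lra.
  - rewrite leb3_box; [|by rewrite kS; have := ki i; lra|by lra|by lra].
    by rewrite lte_fin !mulr_gt0//; rewrite ?kS; lra.
move=> [[/= + _] _] [[/= + _] _]; rewrite !in_itv/=.
move=> /andP[xi ix] /andP[xj jx]; apply/val_inj/eqP; rewrite eqn_leq.
suff le (u v : nat) : a - k * u.+1%:R < x -> x <= a - k * v%:R -> (v <= u)%N.
  by rewrite (le j i) ?(le i j).
move=> xu xv; rewrite -ltnS -(ltr_nat R) -(ltr_pM2l k0); lra.
Qed.

Let cube : set R3 := [set` `[- pi : R, pi]] `*` [set` `[- pi : R, pi]] `*`
  [set` `[- pi : R, pi]].

Let cube_compact : compact cube.
Proof.
by apply: compact_setX; [apply: compact_setX|]; apply: segment_compact.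
Qed.

Let torus_sub_cube : @torus R `<=` cube.
Proof.
by move=> [[t1 t2] t3] [[t1P t2P] t3P]; split; [split|];
  apply: subset_itv_oc_cc.
Qed.

Lemma torus0 : torus (0 : R3).
Proof.
have := pi_gt0 R => pi0.
by split; [split|]; rewrite /= in_itv/=; apply/andP; split; lra.
Qed.

Let cube0 : cube !=set0.
Proof. by exists 0; apply: torus_sub_cube; exact: torus0. Qed.

Lemma torus_bounded (f : R3 -> R) : continuous f ->
  exists B, forall q, torus q -> `|f q| <= B.
Proof.
move=> cf.
have cg : {within cube, continuous (fun q => `|f q|)}.
  by apply: continuous_subspaceT => q; apply: cvg_norm; apply: cf.
have [q _ qmax] := compact_EVT_max cube0 cube_compact cg.
by exists `|f q| => t tt; apply: qmax; rewrite inE; exact: torus_sub_cube.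
Qed.

(** The half-open cube is not compact: the minimum over its closure is brought
    back into it by shifting by 2 pi the coordinates that equal -pi. *)
Lemma torus_min_attained (f : R3 -> R) : torus_periodic (@e3 R) f ->
  continuous f -> exists2 q, torus q & forall t, torus t -> f q <= f t.
Proof.
move=> pf cf; have pi0 := pi_gt0 R.
have [q Kq qmin] :=
  compact_EVT_min cube0 cube_compact (continuous_subspaceT cf).
have fold (x : R) : `[- pi, pi]%classic x ->
    exists b : bool, x + (2 * pi) *+ b \in `]- pi, pi].
  rewrite /= in_itv/= => /andP[x1 x2].
  have [xp|xp] := ltP (- pi) x.
    by exists false => //; rewrite addr0 in_itv/= xp.
  by exists true => //; rewrite in_itv/=; apply/andP; split; lra.
case: q Kq qmin => [[a b] c]; rewrite inE => -[[/=]].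
move=> /fold[i ia] /fold[j jb] /fold[k kc] qmin.
have shift (s : 'I_3) (e : bool) x : f (x + ((2 * pi) *+ e) *: e3 R s) = f x.
  by case: e; rewrite ?mulr1n ?mulr0n ?scale0r ?addr0.
exists (a + (2 * pi) *+ i, b + (2 * pi) *+ j, c + (2 * pi) *+ k).
  by [].
move=> t tt.
have -> : (a + (2 * pi) *+ i, b + (2 * pi) *+ j, c + (2 * pi) *+ k) =
    (a, b, c) + ((2 * pi) *+ i) *: e3 R 0 + ((2 * pi) *+ j) *: e3 R 1
      + ((2 * pi) *+ k) *: e3 R 2%:R.
  by congr (_, _, _) => /=; rewrite /GRing.scale/=; lra.
by rewrite !shift; apply: qmin; rewrite inE; exact: torus_sub_cube.
Qed.

End TorusTopology.

(** * Square integrable functions on a set of finite measure *)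

Section SquareIntegrable.
Context d (T : measurableType d) (R : realType) (m : {measure set T -> \bar R}).
Context (D : set T).
Hypothesis mD : measurable D.
Hypothesis mDoo : (m D < +oo)%E.
Implicit Types a b f g : T -> R.

Local Notation integ f := (\int[m]_(x in D) f x).
Local Notation integrable_on f := (m.-integrable D (EFin \o f)).

Definition sq_integrable a :=
  measurable_fun D a /\ integrable_on (fun x => a x ^+ 2).

Definition bounded_measurable b :=
  measurable_fun D b /\ exists B, forall x, D x -> `|b x| <= B.

Lemma integral_EFin a : integrable_on a ->
  (\int[m]_(x in D) (a x)%:E)%E = (integ a)%:E.
Proof. by move=> ia; rewrite /Rintegral fineK// (integrable_fin_num mD ia). Qed.

Lemma bounded_measurable_integrable b : bounded_measurable b -> integrable_on b.
Proof.
move=> [mb [B bB]]; apply: measurable_bounded_integrable => //.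
exists B; split; first exact: num_real.
by move=> y By x Dx; apply: (le_trans (bB x Dx)); exact: ltW.
Qed.

Lemma bounded_measurableM a b : bounded_measurable a -> bounded_measurable b ->
  bounded_measurable (fun x => a x * b x).
Proof.
move=> [ma [A aA]] [mb [B bB]]; split; first exact: measurable_funM.
by exists (A * B) => x Dx; rewrite normrM ler_pM// ?aA ?bB.
Qed.

Lemma bounded_measurableD a b : bounded_measurable a -> bounded_measurable b ->
  bounded_measurable (fun x => a x + b x).
Proof.
move=> [ma [A aA]] [mb [B bB]]; split; first exact: measurable_funD.
by exists (A + B) => x Dx; rewrite (le_trans (ler_normD _ _))// lerD ?aA ?bB.
Qed.

Lemma bounded_measurable_cst k : bounded_measurable (fun=> k).
Proof. by split; [exact: measurable_cst|exists `|k|]. Qed.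

Lemma bounded_measurable_inv a (e : R) : 0 < e -> measurable_fun D a ->
  (forall x, D x -> e <= a x) -> bounded_measurable (fun x => (a x)^-1).
Proof.
move=> e0 ma ea; split; last first.
  exists e^-1 => x Dx; have ax := ea x Dx; have ax0 := lt_le_trans e0 ax.
  by rewrite gtr0_norm ?invr_gt0// lef_pV2 ?posrE.
have mpos : measurable [set` `]0 : R, +oo[] by exact: measurable_itv.
rewrite [X in measurable_fun _ X](_ : _ = (@GRing.inv R) \o a)//.
apply: (measurable_comp mpos) => //.
- move=> _ [x Dx <-]; rewrite /= in_itv/= andbT.
  exact: lt_le_trans e0 (ea x Dx).
- apply: open_continuous_measurable_fun; first exact: interval_open.
  move=> x; rewrite inE/= in_itv/= andbT => x0.
  by apply: inv_continuous; rewrite gt_eqF.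
Qed.

Lemma sq_integrableM a b : sq_integrable a -> sq_integrable b ->
  integrable_on (fun x => a x * b x).
Proof.
move=> [ma ia] [mb ib].
apply: (le_integrable mD _ _ (integrableD mD ia ib)).
  by apply/measurable_EFinP; exact: measurable_funM.
move=> x Dx; rewrite /= lee_fin normrM [leRHS]ger0_norm ?addr_ge0 ?sqr_ge0//.
rewrite -(real_normK (num_real (a x))) -(real_normK (num_real (b x))).
have := sqr_ge0 (`|a x| - `|b x|).
have := mulr_ge0 (normr_ge0 (a x)) (normr_ge0 (b x)).
rewrite sqrrB; lra.
Qed.

Lemma bounded_sq_integrable b : bounded_measurable b -> sq_integrable b.
Proof.
move=> bb; split; first by case: bb.
apply: bounded_measurable_integrable.
exact: (bounded_measurableM bb bb).
Qed.

Lemma sq_integrableMl b a : bounded_measurable b -> sq_integrable a ->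
  sq_integrable (fun x => b x * a x).
Proof.
move=> [mb [B bB]] [ma ia]; split; first exact: measurable_funM.
apply: (le_integrable mD _ _ (integrableZl mD (B ^+ 2) ia)).
  by apply/measurable_EFinP/measurable_funX/measurable_funM.
move=> x Dx; rewrite /= lee_fin (ger0_norm (sqr_ge0 _)).
rewrite (ger0_norm (mulr_ge0 (sqr_ge0 _) (sqr_ge0 _))).
rewrite exprMn ler_wpM2r ?sqr_ge0// -(real_normK (num_real (b x))).
have B0 : 0 <= B := le_trans (normr_ge0 _) (bB x Dx).
by rewrite ler_pXn2r ?nnegrE ?bB.
Qed.

Lemma sq_integrableD a b : sq_integrable a -> sq_integrable b ->
  sq_integrable (fun x => a x + b x).
Proof.
move=> sa sb; have [[ma ia] [mb ib]] := (sa, sb).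
split; first exact: measurable_funD.
have iab := integrableZl mD 2 (sq_integrableM sa sb).
apply: eq_integrable (integrableD mD (integrableD mD ia ib) iab) => // x _.
by rewrite /= -!EFinD; congr EFin; rewrite sqrrD mulr2n; lra.
Qed.

Lemma sq_integrableZ k a : sq_integrable a -> sq_integrable (fun x => k * a x).
Proof. exact: sq_integrableMl (bounded_measurable_cst k). Qed.

Lemma integral_sqr_ge0 a : 0 <= integ (fun x => a x ^+ 2).
Proof. by apply: Rintegral_ge0 => x _; rewrite sqr_ge0. Qed.

Lemma le_integral_sqr a b (k : R) : sq_integrable a -> sq_integrable b ->
  (forall x, D x -> a x ^+ 2 <= k * b x ^+ 2) ->
  integ (fun x => a x ^+ 2) <= k * integ (fun x => b x ^+ 2).
Proof.
move=> [_ ia] [_ ib] ab; rewrite -RintegralZl//.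
by apply: le_Rintegral => //; exact: (integrableZl mD k ib).
Qed.

Lemma integral_sqrD a b : sq_integrable a -> sq_integrable b ->
  integ (fun x => (a x + b x) ^+ 2) <=
  2 * integ (fun x => a x ^+ 2) + 2 * integ (fun x => b x ^+ 2).
Proof.
move=> sa sb; have [[ma ia] [mb ib]] := (sa, sb).
rewrite -!RintegralZl// -RintegralD//; last 2 first.
- exact: (integrableZl mD 2 ia).
- exact: (integrableZl mD 2 ib).
apply: le_Rintegral => //.
- by have [] := sq_integrableD sa sb.
- have i2a : integrable_on (fun x => 2 * a x ^+ 2) := integrableZl mD 2 ia.
  have i2b : integrable_on (fun x => 2 * b x ^+ 2) := integrableZl mD 2 ib.
  exact: (integrableD mD i2a i2b).
- by move=> x _; have := sqr_ge0 (a x - b x); rewrite sqrrB sqrrD; lra.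
Qed.

(** Obtained by integrating (t a - b)^2 >= 0. The added 1 keeps the
    denominator of the chosen t positive even if [a] vanishes almost
    everywhere. *)
Lemma cauchy_schwarz a b : sq_integrable a -> sq_integrable b ->
  integ (fun x => a x * b x) ^+ 2 <=
  (integ (fun x => a x ^+ 2) + 1) * integ (fun x => b x ^+ 2).
Proof.
move=> sa sb; have [[ma ia] [mb ib]] := (sa, sb).
set P := integ (fun x => a x ^+ 2); set Q := integ (fun x => b x ^+ 2).
have iab := sq_integrableM sa sb.
set X := integ (fun x => a x * b x).
have P0 : 0 <= P := integral_sqr_ge0 a.
have quad (t : R) : 2 * t * X <= t ^+ 2 * P + Q.
  rewrite /X /P /Q -!RintegralZl// -RintegralD//;
    last exact: (integrableZl mD _ ia).
  apply: le_Rintegral => //.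
  - exact: (integrableZl mD (2 * t) iab).
  - have i2a : integrable_on (fun x => t ^+ 2 * a x ^+ 2).
      exact: (integrableZl mD _ ia).
    exact: (integrableD mD i2a ib).
  - by move=> x _; have := sqr_ge0 (t * a x - b x); rewrite sqrrB exprMn; lra.
have P1 : 0 < P + 1 by lra.
have := quad (X / (P + 1)).
have : (X / (P + 1)) ^+ 2 * P <= (X / (P + 1)) ^+ 2 * (P + 1).
  by rewrite ler_wpM2l ?sqr_ge0//; lra.
have -> : (X / (P + 1)) ^+ 2 * (P + 1) = X ^+ 2 / (P + 1) by field; lra.
have -> : 2 * (X / (P + 1)) * X = 2 * (X ^+ 2 / (P + 1)) by ring.
move=> h1 h2; have : X ^+ 2 / (P + 1) <= Q by lra.
by rewrite ler_pdivrMr// mulrC.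
Qed.

Lemma integral_sqr_eq0 a : sq_integrable a -> integ (fun x => a x ^+ 2) <= 0 ->
  ae_eq m D a (fun=> 0).
Proof.
move=> [ma ia] I0.
have : (\int[m]_(x in D) `|(a x ^+ 2)%:E|)%E = 0%E.
  rewrite (eq_integral (fun x => (a x ^+ 2)%:E)) => [|x _].
    rewrite integral_EFin//; congr EFin; apply/eqP.
    by rewrite eq_le I0 integral_sqr_ge0.
  by rewrite gee0_abs// lee_fin sqr_ge0.
have mE : measurable_fun D (fun x => (a x ^+ 2)%:E).
  by apply/measurable_EFinP; exact: measurable_funX.
move/(ae_eq_integral_abs m mD mE).
apply: filterS => x /[swap] Dx /(_ Dx)/= [] /eqP.
by rewrite sqrf_eq0 => /eqP.
Qed.

Lemma ae_eq_Rintegral a b : measurable_fun D a -> measurable_fun D b ->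
  ae_eq m D a b -> integ a = integ b.
Proof.
move=> ma mb ab; congr fine; apply: ae_eq_integral => //.
- exact/measurable_EFinP.
- exact/measurable_EFinP.
- by apply: filterS ab => x /[swap] Dx /(_ Dx) ->.
Qed.

End SquareIntegrable.

(** * Real rank-one perturbations of multiplication operators *)

Section RankOnePerturbation.
Context d (T : measurableType d) (R : realType) (m : {measure set T -> \bar R}).
Context (D : set T) (mD : measurable D) (mDoo : (m D < +oo)%E).
Context (w phi : T -> R) (e M : R).
Hypothesis mw : measurable_fun D w.
Hypothesis we : forall x, D x -> e <= w x.
Hypothesis wM : forall x, D x -> w x <= M.
Hypothesis bphi : bounded_measurable D phi.
Implicit Types (a g : T -> R) (mu z : R).

Local Notation integ f := (\int[m]_(x in D) f x).
Local Notation integrable_on f := (m.-integrable D (EFin \o f)).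
Local Notation sqi := (sq_integrable m D).
Local Notation bdd := (bounded_measurable D).

Definition rank_one mu a : T -> R :=
  fun x => w x * a x - mu * phi x * integ (fun t => phi t * a t).

(** This is Lambda(p, .) when [w] is u_p. *)
Definition secular z : R := integ (fun t => phi t ^+ 2 / (w t - z)).

Let wz_gt0 z x : z < e -> D x -> 0 < w x - z.
Proof. by move=> ze /we ew; lra. Qed.

Lemma bounded_symbol : bdd w.
Proof.
split; first exact: mw.
exists (`|e| + `|M|) => x Dx; have := we Dx; have := wM Dx.
have := ler_norm e; have := ler_norm (- e); rewrite normrN.
have := ler_norm M; have := normr_ge0 M; have := normr_ge0 e.
by rewrite ler_norml => *; apply/andP; split; lra.
Qed.

Lemma bounded_resolvent z : z < e -> bdd (fun x => (w x - z)^-1).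
Proof.
move=> ze; apply: (@bounded_measurable_inv _ _ _ _ _ (e - z)).
- by lra.
- by apply: measurable_funB => //; exact: measurable_cst.
- by move=> x /we; lra.
Qed.

Lemma bounded_resolvent_vector z : z < e ->
  bdd (fun x => phi x / (w x - z)).
Proof.
by move=> ze; exact: bounded_measurableM bphi (bounded_resolvent ze).
Qed.

Let secular_integrand_bdd z : z < e -> bdd (fun t => phi t ^+ 2 / (w t - z)).
Proof.
move=> ze; apply: bounded_measurableM (bounded_resolvent ze).
exact: bounded_measurableM bphi bphi.
Qed.

Lemma secular_integrable z : z < e ->
  integrable_on (fun t => phi t ^+ 2 / (w t - z)).
Proof.
move=> ze; exact: bounded_measurable_integrable (secular_integrand_bdd ze).
Qed.

Lemma secular_ge0 z : z < e -> 0 <= secular z.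
Proof.
move=> ze; apply: Rintegral_ge0 => x Dx.
by rewrite mulr_ge0 ?sqr_ge0// invr_ge0 ltW// wz_gt0.
Qed.

(** For fixed z < z' < e, the quotient (w - z') / (w - z) of the two integrands
    increases with the value of [w], hence lies between its values at [e] and
    at [M]; this gives both ratio bounds. *)
Lemma secular_lower z z' : z < z' -> z' < e ->
  (e - z') / (e - z) * secular z' <= secular z.
Proof.
move=> zz' z'e; have ze := lt_trans zz' z'e.
rewrite -RintegralZl//; last exact: secular_integrable.
apply: le_Rintegral => //.
- exact: (integrableZl mD _ (secular_integrable z'e)).
- exact: secular_integrable.
move=> x Dx; have h := wz_gt0 ze Dx; have h' := wz_gt0 z'e Dx.
rewrite mulrCA ler_wpM2l ?sqr_ge0//.
have ew := we Dx.
rewrite ler_pdivrMr// [leRHS]mulrC ler_pdivlMr// mulrAC ler_pdivrMr;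
  last by lra.
by have := mulr_ge0 (ltW (_ : 0 < z' - z)) (_ : 0 <= w x - e); nra.
Qed.

Lemma secular_upper z z' : z < z' -> z' < e ->
  secular z <= (M - z') / (M - z) * secular z'.
Proof.
move=> zz' z'e; have ze := lt_trans zz' z'e.
rewrite -RintegralZl//; last exact: secular_integrable.
apply: le_Rintegral => //.
- exact: secular_integrable.
- exact: (integrableZl mD _ (secular_integrable z'e)).
move=> x Dx; have h := wz_gt0 ze Dx; have h' := wz_gt0 z'e Dx.
rewrite mulrCA ler_wpM2l ?sqr_ge0//.
have ew := wM Dx.
rewrite ler_pdivlMr// mulrC ler_pdivrMr// mulrAC ler_pdivlMr; last by lra.
by have := mulr_ge0 (ltW (_ : 0 < z' - z)) (_ : 0 <= M - w x); nra.
Qed.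

Lemma sq_integrable_rank_one mu z a : sqi a ->
  sqi (fun x => rank_one mu a x - z * a x).
Proof.
move=> sa; pose k := integ (fun x => phi x * a x).
have -> : (fun x => rank_one mu a x - z * a x) =
    (fun x => w x * a x + - (mu * k) * phi x + - z * a x).
  by apply/funext => x; rewrite /rank_one -/k; ring.
have sphi := bounded_sq_integrable mD mDoo bphi.
have s2 := sq_integrableZ mD (- (mu * k)) sphi.
have s3 := sq_integrableZ mD (- z) sa.
have s4 := sq_integrableMl mD bounded_symbol sa.
exact (sq_integrableD mD (sq_integrableD mD s4 s2) s3).
Qed.

(** The resolvent in closed form: [a] must be (g + mu k phi) / (w - z) with
    k the integral of phi a, and integrating this against phi gives the linear
    equation k (1 - mu secular z) = integral of phi g / (w - z). *)
Lemma rank_one_solve mu z g : z < e -> mu * secular z != 1 -> sqi g ->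
  exists2 a, sqi a & forall x, D x -> rank_one mu a x - z * a x = g x.
Proof.
move=> ze s1 sg; pose s := 1 - mu * secular z.
have s0 : s != 0 by rewrite subr_eq0 eq_sym.
pose k := integ (fun x => phi x / (w x - z) * g x) / s.
pose a x := (w x - z)^-1 * (g x + mu * k * phi x).
have sphi : sqi (fun x => mu * k * phi x).
  by apply/sq_integrableZ/bounded_sq_integrable.
have sa : sqi a.
  apply: sq_integrableMl (bounded_resolvent ze) _ => //.
  exact: sq_integrableD.
exists a => // x Dx.
have ipsig : integrable_on (fun x => phi x / (w x - z) * g x).
  apply: sq_integrableM => //.
  by apply/bounded_sq_integrable/bounded_resolvent_vector.
have -> : rank_one mu a x = w x * a x - mu * phi x * k.
  congr (_ - _ * _).
  rewrite (@eq_Rintegral _ _ _ m D (fun x => phi x / (w x - z) * g x +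
     mu * k * (phi x ^+ 2 / (w x - z)))); last first.
    by move=> y _; rewrite /a; ring.
  have isec := secular_integrable ze.
  have isec2 : integrable_on (fun x => mu * k * (phi x ^+ 2 / (w x - z))).
    exact: (integrableZl mD _ isec).
  rewrite RintegralD// RintegralZl// -/(secular z).
  have -> : integ (fun x => phi x / (w x - z) * g x) = k * s.
    by rewrite /k divfK.
  by rewrite /s; ring.
have := wz_gt0 ze Dx => h; rewrite /a; field; lra.
Qed.

(** In the formula for the resolvent, the coefficient k is controlled by
    Cauchy-Schwarz and the factor 1 / (w - z) by 1 / (e - z). *)
Lemma rank_one_bounded_below mu z : z < e -> mu * secular z != 1 ->
  exists2 C, 0 < C & forall a, sqi a ->
    integ (fun x => a x ^+ 2) <=
    C * integ (fun x => (rank_one mu a x - z * a x) ^+ 2).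
Proof.
move=> ze s1; pose s := 1 - mu * secular z.
have s0 : s != 0 by rewrite subr_eq0 eq_sym.
have bpsi := bounded_resolvent_vector ze.
have sphi := bounded_sq_integrable mD mDoo bphi.
have spsi := bounded_sq_integrable mD mDoo bpsi.
pose P := integ (fun x => (phi x / (w x - z)) ^+ 2) + 1.
pose F := integ (fun x => phi x ^+ 2).
have P0 : 0 <= P by rewrite addr_ge0// integral_sqr_ge0.
have F0 : 0 <= F by exact: integral_sqr_ge0.
pose K := 2 + 2 * (mu ^+ 2 * F * (P / s ^+ 2)).
have K0 : 0 < K.
  have : 0 <= mu ^+ 2 * F * (P / s ^+ 2).
    by apply: mulr_ge0; [apply: mulr_ge0|apply: divr_ge0]; rewrite ?sqr_ge0.
  by rewrite /K; lra.
have ez0 : 0 < (e - z)^-1 ^+ 2 by rewrite exprn_gt0// invr_gt0; lra.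
exists ((e - z)^-1 ^+ 2 * K); first by rewrite mulr_gt0.
move=> a sa.
pose k := integ (fun x => phi x * a x).
pose g x := rank_one mu a x - z * a x.
have sg : sqi g := sq_integrable_rank_one mu z sa.
set Q := integ (fun x => (rank_one mu a x - z * a x) ^+ 2).
have Q0 : 0 <= Q := integral_sqr_ge0 _ _ _.
have ks : integ (fun x => phi x / (w x - z) * g x) = k * s.
  have isec := secular_integrable ze.
  have isec2 : integrable_on (fun x => mu * k * (phi x ^+ 2 / (w x - z))).
    exact: (integrableZl mD _ isec).
  rewrite (@eq_Rintegral _ _ _ m D (fun x => phi x * a x -
     mu * k * (phi x ^+ 2 / (w x - z)))); last first.
    move=> x; rewrite inE => Dx; have := wz_gt0 ze Dx => h.
    by rewrite /g /rank_one -/k; field; lra.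
  rewrite RintegralB//; last exact: sq_integrableM.
  by rewrite RintegralZl// -/(secular z) -/k /s; ring.
have kPQ : k ^+ 2 <= P / s ^+ 2 * Q.
  rewrite mulrAC ler_pdivlMr ?exprn_even_gt0//= -exprMn -ks.
  exact: (cauchy_schwarz mD spsi sg).
have sk := sq_integrableZ mD (mu * k) sphi.
have := le_integral_sqr (k := (e - z)^-1 ^+ 2) mD sa (sq_integrableD mD sg sk).
move=> /(_ _) /le_trans; apply.
  move=> x Dx; have h := wz_gt0 ze Dx.
  have -> : g x + mu * k * phi x = (w x - z) * a x.
    by rewrite /g /rank_one -/k; ring.
  rewrite exprMn mulrA -exprMn ler_peMl ?sqr_ge0//.
  rewrite exprn_ege1// mulrC ler_pdivlMr ?mul1r; last by lra.
  by have := we Dx; lra.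
rewrite -[leRHS]mulrA ler_wpM2l//; first exact: ltW.
apply: (le_trans (integral_sqrD mD sg sk)).
have -> : integ (fun x => (mu * k * phi x) ^+ 2) = (mu * k) ^+ 2 * F.
  rewrite /F -(RintegralZl ((mu * k) ^+ 2) mD (proj2 sphi)).
  by apply: eq_Rintegral => x _; rewrite exprMn.
have muF : 0 <= mu ^+ 2 * F by rewrite mulr_ge0 ?sqr_ge0.
have := ler_wpM2l muF kPQ; rewrite -/Q /K exprMn; lra.
Qed.

Lemma rank_one_eigenvector mu z a : z < e ->
  ae_eq m D (rank_one mu a) (fun x => z * a x) ->
  ae_eq m D a
    (fun x => mu * integ (fun t => phi t * a t) * (phi x / (w x - z))).
Proof.
move=> ze; pose k := integ (fun t => phi t * a t); rewrite -/k.
apply: filterS => x /[swap] Dx /(_ Dx); rewrite /rank_one -/k => Ta.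
have h := wz_gt0 ze Dx.
have : (w x - z) * a x = mu * k * phi x by rewrite mulrBl; lra.
have h0 : w x - z != 0 by rewrite gt_eqF.
by move=> /(canRL (mulKf h0)) ->; rewrite mulrC mulrA.
Qed.

Lemma rank_one_eigenvector0 mu z a : z < e -> mu * secular z != 1 -> sqi a ->
  ae_eq m D (rank_one mu a) (fun x => z * a x) -> ae_eq m D a (fun=> 0).
Proof.
move=> ze s1 sa Ta; have [C _ aC] := rank_one_bounded_below ze s1.
apply: integral_sqr_eq0 => //; apply: (le_trans (aC a sa)).
have [mg ig] := sq_integrable_rank_one mu z sa.
rewrite (@ae_eq_Rintegral _ _ _ m D mD _ (fun=> 0)).
- by rewrite Rintegral_cst// mul0r mulr0.
- exact: measurable_funX.
- exact: measurable_cst.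
- by apply: filterS Ta => x /[swap] Dx /(_ Dx) ->; rewrite subrr expr0n.
Qed.

End RankOnePerturbation.

(** * Complex square integrable functions on the torus *)

Section ComplexL2.
Local Open Scope complex_scope.
Context (R : realType).
Local Notation R3 := (R * R * R)%type.
Local Notation sqi := (sq_integrable (leb3 R) (@torus R)).
Local Notation integ f := (\int[leb3 R]_(t in @torus R) f t).
Implicit Types f g : R3 -> R[i].

Lemma L2P f :
  L2 f <-> sqi (fun q => complex.Re (f q)) /\ sqi (fun q => complex.Im (f q)).
Proof.
split=> [[mre mim foo]|[[mre ire] [mim iim]]].
  have sub (a : R3 -> R) : measurable_fun (@torus R) a ->
      (forall q, a q ^+ 2 <= complex.Re (f q) ^+ 2 + complex.Im (f q) ^+ 2) ->
      sqi a.
    move=> ma af; split => //; apply/integrableP; split.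
      by apply/measurable_EFinP; exact: measurable_funX.
    apply: le_lt_trans foo; apply: ge0_le_integral => //.
    - exact: measurable_torus.
    - apply: measurableT_comp => //.
      by apply/measurable_EFinP; exact: measurable_funX.
    - by apply/measurable_EFinP; apply: measurable_funD; exact: measurable_funX.
    - by move=> q _; rewrite /= lee_fin ger0_norm ?sqr_ge0.
  split; [apply (sub _ mre)|apply (sub _ mim)] => q.
    by rewrite lerDl sqr_ge0.
  by rewrite lerDr sqr_ge0.
split => //; have := integrableD (@measurable_torus R) ire iim.
by move/(integrable_lty (@measurable_torus R)).
Qed.

Lemma L2_normsqE f : L2 f -> L2_normsq f =
  (integ (fun q => complex.Re (f q) ^+ 2) +
   integ (fun q => complex.Im (f q) ^+ 2))%:E.
Proof.
move=> /L2P[[_ ire] [_ iim]].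
rewrite -RintegralD//; last exact: measurable_torus.
rewrite -integral_EFin//; first exact: measurable_torus.
exact: (integrableD (@measurable_torus R) ire iim).
Qed.

Lemma L2_of_real (a : R3 -> R) : sqi a -> L2 (fun q => (a q)%:C).
Proof.
move=> sa; apply/L2P; split => //=.
apply: bounded_sq_integrable; [exact: measurable_torus|exact: leb3_torus|].
exact: bounded_measurable_cst.
Qed.

Lemma L2_normsq_real (a : R3 -> R) : sqi a ->
  L2_normsq (fun q => (a q)%:C) = (integ (fun q => a q ^+ 2))%:E.
Proof.
move=> sa; rewrite L2_normsqE /=; last exact: L2_of_real.
congr EFin; rewrite [X in _ + X](_ : _ = 0) ?addr0//.
by rewrite expr0n/= Rintegral_cst ?mul0r//; exact: measurable_torus.
Qed.

Lemma L2_eqP f g : L2_eq f g <->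
  ae_eq (leb3 R) (@torus R)
    (fun q => complex.Re (f q)) (fun q => complex.Re (g q)) /\
  ae_eq (leb3 R) (@torus R)
    (fun q => complex.Im (f q)) (fun q => complex.Im (g q)).
Proof.
split=> [fg|[re im]].
  by split; apply: filterS fg => q /[swap] tq /(_ tq) ->.
apply: filterS2 re im => q /= re im tq.
by apply/eqP; rewrite eq_complex re// im// !eqxx.
Qed.

End ComplexL2.

(** * Spectrum of the operator *)

Lemma inf_image_min (R : realType) (T : Type) (A : set T) (f : T -> R) x :
  A x -> (forall y, A y -> f x <= f y) -> inf (f @` A) = f x.
Proof.
move=> Ax fmin; apply/eqP; rewrite eq_le; apply/andP; split.
  apply: ge_inf; last by exists x.
  by exists (f x) => _ [y Ay <-]; exact: fmin.
apply: lb_le_inf; first by exists (f x), x.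
by move=> _ [y Ay <-]; exact: fmin.
Qed.

Lemma left_kernel_vector (F : fieldType) n (C : 'M[F]_(n.+1, n)) :
  exists2 y : 'rV_n.+1, y != 0 & y *m C = 0.
Proof.
exists (nz_row (kermx C)); last by apply/sub_kermxP; exact: nz_row_sub.
rewrite nz_row_eq0 kermx_eq0 /row_free; apply/eqP => rC.
by have := rank_leq_col C; rewrite rC ltnn.
Qed.

Section Hop.
Local Open Scope complex_scope.
Context (R : realType).
Context (u : (R * R * R) * (R * R * R) -> R) (phi : R * R * R -> R).
Context (p q0 : R * R * R).
Local Notation R3 := (R * R * R)%type.
Local Notation w := (fun q => u (p, q)).
Hypothesis w_continuous : continuous w.
Hypothesis phi_continuous : continuous phi.
Hypothesis q0_torus : torus q0.
Hypothesis q0_min : forall q, torus q -> u (p, q0) <= u (p, q).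
Implicit Types (f g : R3 -> R[i]) (mu z : R).
Local Notation sqi := (sq_integrable (leb3 R) (@torus R)).
Local Notation bdd := (bounded_measurable (@torus R)).
Local Notation integ f := (\int[leb3 R]_(t in @torus R) f t).
Local Notation T := (rank_one (leb3 R) (@torus R) w phi).
Local Notation L := (secular (leb3 R) (@torus R) w phi).
Local Notation mD := (@measurable_torus R).
Local Notation mDoo := (@leb3_torus R).

Lemma u_minE : u_min u p = u (p, q0).
Proof. exact: inf_image_min. Qed.

Let mw : measurable_fun (@torus R) w.
Proof. exact: continuous3_measurable mD w_continuous. Qed.

Let bphi : bdd phi.
Proof.
split; first exact: continuous3_measurable mD phi_continuous.
exact: torus_bounded.
Qed.

Let we q : torus q -> u_min u p <= w q.
Proof. by move=> tq; rewrite u_minE; exact: q0_min. Qed.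

Let w_upper : exists M, forall q, torus q -> w q <= M.
Proof.
have [M wM] := torus_bounded w_continuous.
by exists M => q /wM; apply: le_trans; exact: ler_norm.
Qed.

Lemma Re_hop mu f q : complex.Re (hop u phi mu p f q) =
  T mu (fun t => complex.Re (f t)) q.
Proof.
rewrite /hop /rank_one /cintegral; case: (f q) => a b /=.
rewrite [X in _ - (_ * X - _)]
  (_ : _ = integ (fun t => phi t * complex.Re (f t))).
  by ring.
by apply: eq_Rintegral => t _; case: (f t) => c e /=; ring.
Qed.

Lemma Im_hop mu f q : complex.Im (hop u phi mu p f q) =
  T mu (fun t => complex.Im (f t)) q.
Proof.
rewrite /hop /rank_one /cintegral; case: (f q) => a b /=.
rewrite [X in _ - (_ * X + _)]
  (_ : _ = integ (fun t => phi t * complex.Im (f t))).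
  by ring.
by apply: eq_Rintegral => t _; case: (f t) => c e /=; ring.
Qed.

Lemma Lambda_intE z : z < u_min u p -> Lambda_int u phi p z = (L z)%:E.
Proof.
have [M wM] := w_upper => ze; apply: integral_EFin => //; first exact: mD.
exact: (secular_integrable mD mDoo mw we bphi ze).
Qed.

Let L2_hop_sub mu z f : L2 f -> L2 (fun q => hop u phi mu p f q - z%:C * f q).
Proof.
have [M wM] := w_upper; move=> /L2P[sre sim]; apply/L2P; split.
  have := sq_integrable_rank_one mD mDoo mw we wM bphi mu z sre.
  congr sq_integrable; apply/funext => q; rewrite -Re_hop.
  by case: (hop _ _ _ _ _ _) (f q) => [a b] [c e] /=; ring.
have := sq_integrable_rank_one mD mDoo mw we wM bphi mu z sim.
congr sq_integrable; apply/funext => q; rewrite -Im_hop.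
by case: (hop _ _ _ _ _ _) (f q) => [a b] [c e] /=; ring.
Qed.

Let Re_hop_sub mu z f q : complex.Re (hop u phi mu p f q - z%:C * f q) =
  T mu (fun t => complex.Re (f t)) q - z * complex.Re (f q).
Proof.
rewrite -Re_hop.
by case: (hop _ _ _ _ _ _) (f q) => [a b] [c e] /=; ring.
Qed.

Let Im_hop_sub mu z f q : complex.Im (hop u phi mu p f q - z%:C * f q) =
  T mu (fun t => complex.Im (f t)) q - z * complex.Im (f q).
Proof.
rewrite -Im_hop.
by case: (hop _ _ _ _ _ _) (f q) => [a b] [c e] /=; ring.
Qed.

Let eigen_Re_Im mu z f : L2_eq (hop u phi mu p f) (fun q => z%:C * f q) ->
  ae_eq (leb3 R) (@torus R) (T mu (fun t => complex.Re (f t)))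
    (fun q => z * complex.Re (f q)) /\
  ae_eq (leb3 R) (@torus R) (T mu (fun t => complex.Im (f t)))
    (fun q => z * complex.Im (f q)).
Proof.
move=> /L2_eqP[re im]; split.
  apply: filterS re => q /[swap] tq /(_ tq); rewrite Re_hop => ->.
  by case: (f q) => c e /=; ring.
apply: filterS im => q /[swap] tq /(_ tq); rewrite Im_hop => ->.
by case: (f q) => c e /=; ring.
Qed.

Lemma hop_resolvent mu z : z < u_min u p -> mu * L z != 1 ->
  in_resolvent_set (hop u phi mu p) z.
Proof.
have [M wM] := w_upper; move=> ze s1; split.
  have [C C0 aC] := rank_one_bounded_below mD mDoo mw we wM bphi ze s1.
  exists C => // f f2.
  rewrite (L2_normsqE f2) (L2_normsqE (L2_hop_sub mu z f2)).
  have [sre sim] := (L2P f).1 f2.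
  rewrite -EFinM lee_fin mulrDr lerD//.
    rewrite (le_trans (aC _ sre))// le_eqVlt; apply/orP; left; apply/eqP.
    by congr (_ * _); apply: eq_Rintegral => q _; rewrite Re_hop_sub.
  rewrite (le_trans (aC _ sim))// le_eqVlt; apply/orP; left; apply/eqP.
  by congr (_ * _); apply: eq_Rintegral => q _; rewrite Im_hop_sub.
move=> g /L2P[sre sim].
have [a sa Ta] := rank_one_solve mD mDoo mw we bphi ze s1 sre.
have [b sb Tb] := rank_one_solve mD mDoo mw we bphi ze s1 sim.
exists (fun q => a q +i* b q); first by apply/L2P.
apply: aeW => q tq; apply/eqP; rewrite eq_complex Re_hop_sub Im_hop_sub/=.
by rewrite Ta// Tb// !eqxx.
Qed.

(** If mu * Lambda(p, z) <> 1, the real operator minus z is bounded below, hence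
    injective, and both parts of an eigenfunction vanish. *)
Lemma hop_eigenvalue_secular mu z : z < u_min u p ->
  eigenvalue_of (hop u phi mu p) z -> mu * L z = 1.
Proof.
have [M wM] := w_upper.
move=> ze [f [[/L2P[sre sim] /eigen_Re_Im[re im]] f0]].
apply/eqP/negPn/negP => s1; apply: f0; apply/L2_eqP.
by split; apply: (rank_one_eigenvector0 mD mDoo mw we wM bphi ze s1).
Qed.

(** The eigenfunction is phi / (u_p - z). *)
Lemma hop_secular_eigenvalue mu z : z < u_min u p -> mu * L z = 1 ->
  eigenvalue_of (hop u phi mu p) z.
Proof.
move=> ze s1; pose a q := phi q / (w q - z).
have ba : bdd a := bounded_resolvent_vector mw we bphi ze.
have sa : sqi a := bounded_sq_integrable mD mDoo ba.
have La : integ (fun t => phi t * a t) = L z.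
  by apply: eq_Rintegral => q _; rewrite /a; ring.
exists (fun q => (a q)%:C); split; first split; first exact: L2_of_real.
  apply: aeW => q tq; apply/eqP; rewrite -subr_eq0; apply/eqP.
  apply/eqP; rewrite eq_complex Re_hop_sub Im_hop_sub /=; apply/andP; split.
    have wz : w q - z != 0.
      by rewrite subr_eq0 gt_eqF// (lt_le_trans ze (we tq)).
    have -> : T mu a q - z * a q = (w q - z) * a q - mu * L z * phi q.
      by rewrite /rank_one La; ring.
    by rewrite s1 mul1r /a mulrC divfK// subrr.
  rewrite /rank_one; under eq_Rintegral do rewrite mulr0.
  by rewrite Rintegral_cst ?mul0r ?mulr0 ?subr0//; exact: mD.
move=> /L2_eqP[a0 _].
suff L0 : L z = 0 by move: s1; rewrite L0 mulr0 => /esym/eqP; rewrite oner_eq0.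
rewrite -La (@ae_eq_Rintegral _ _ _ (leb3 R) _ mD _ (fun=> 0)).
- by rewrite Rintegral_cst ?mul0r//; exact: mD.
- by apply: measurable_funM; [case: bphi|case: ba].
- exact: measurable_cst.
- by apply: filterS a0 => q /[swap] tq /(_ tq)/= ->; rewrite mulr0.
Qed.

(** Every eigenfunction is a multiple of phi / (u_p - z). *)
Lemma hop_finite_multiplicity mu z : z < u_min u p ->
  finite_multiplicity (hop u phi mu p) z.
Proof.
move=> ze; pose a q := phi q / (w q - z).
have ba : bdd a := bounded_resolvent_vector mw we bphi ze.
exists 1%N, (fun _ q => (a q)%:C); split.
  by move=> _; apply/L2_of_real/(bounded_sq_integrable mD mDoo ba).
move=> f [f2 /eigen_Re_Im[re im]].
pose k1 := integ (fun t => phi t * complex.Re (f t)).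
pose k2 := integ (fun t => phi t * complex.Im (f t)).
exists (fun=> (mu * k1) +i* (mu * k2)).
have hre := rank_one_eigenvector (m := leb3 R) we ze re.
have him := rank_one_eigenvector (m := leb3 R) we ze im.
apply: filterS2 hre him => q re' im' tq; have {}re' := re' tq.
have {}im' := im' tq.
apply/eqP; rewrite big_ord1 eq_complex re' im' /= -/k1 -/k2 /a.
by apply/andP; split; apply/eqP; ring.
Qed.

Lemma hop_spectrum_below mu z : z < u_min u p ->
  spectrum (hop u phi mu p) z -> mu * L z = 1.
Proof.
move=> ze sz; apply/eqP/negPn/negP => s1; exact/sz/hop_resolvent.
Qed.

Let secularP : exists2 M, u_min u p <= M &
  [/\ forall z, z < u_min u p -> 0 <= L z,
      forall z z', z < z' -> z' < u_min u p ->
        (u_min u p - z') / (u_min u p - z) * L z' <= L z &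
      forall z z', z < z' -> z' < u_min u p ->
        L z <= (M - z') / (M - z) * L z'].
Proof.
have [M wM] := w_upper; exists M.
  exact: le_trans (we q0_torus) (wM _ q0_torus).
split=> *.
- exact: (secular_ge0 (leb3 R) phi we).
- exact: (secular_lower mD mDoo mw we bphi).
- exact: (secular_upper mD mDoo mw we wM bphi).
Qed.

Lemma secular_equation_inj mu z z' : z < u_min u p -> z' < u_min u p ->
  mu * L z = 1 -> mu * L z' = 1 -> z = z'.
Proof.
move=> ze z'e s1 s1'; have [M eM [L0 _ Lup]] := secularP.
have mu0 : mu != 0.
  by apply: contra_eq_neq s1 => ->; rewrite mul0r eq_sym oner_eq0.
apply: (secular_inj eM Lup ze z'e); last by apply: (mulfI mu0); rewrite s1.
rewrite lt_neqAle L0// andbT; apply/eqP => Lz0.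
by move: s1; rewrite -Lz0 mulr0 => /eqP; rewrite eq_sym oner_eq0.
Qed.

(** Below u_min p the spectrum lies in the solution set of
    mu * Lambda(p, z) = 1, which has at most one element; such a point is thus
    isolated. *)
Lemma hop_discrete_below mu z : z < u_min u p ->
  spectrum (hop u phi mu p) z -> discrete_spectrum (hop u phi mu p) z.
Proof.
move=> ze sz; have s1 := hop_spectrum_below ze sz.
split; first exact: hop_secular_eigenvalue.
  exact: hop_finite_multiplicity.
exists (u_min u p - z); first by rewrite subr_gt0.
move=> z' sz' zz'; have z'e : z' < u_min u p.
  by have := ler_norm (z' - z); lra.
exact: secular_equation_inj (hop_spectrum_below z'e sz') s1.
Qed.

Lemma hop_essential_ge mu z :
  essential_spectrum (hop u phi mu p) z -> u_min u p <= z.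
Proof.
move=> [sz nd]; rewrite leNgt; apply/negP => ze.
exact/nd/hop_discrete_below.
Qed.

(** Each function is a combination of the indicators of two boxes near [q1],
    with coefficients that cancel its integral against phi. *)
Lemma test_functions q1 n (eps : R) : torus q1 -> 0 < eps ->
  exists f : 'I_n -> R3 -> R,
  (forall j, [/\ bdd (f j), integ (fun t => phi t * f j t) = 0,
     ~ ae_eq (leb3 R) (@torus R) (f j) (fun=> 0) &
     forall q, f j q != 0 -> `|w q - w q1| < eps]) /\
  (forall i j q, f i q != 0 -> f j q != 0 -> i = j).
Proof.
move=> tq1 eps0.
have nO : nbhs q1 [set q | `|w q - w q1| < eps].
  have /cvgrPdist_lt/(_ _ eps0) := @w_continuous q1.
  by apply: filterS => q; rewrite distrC.
have [A [Aprop Adisj]] := torus_disjoint_boxes (n + n) tq1 nO.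
have bA i : bdd (\1_(A i) : R3 -> R).
  have [mA _ _] := Aprop i; split.
    by apply: measurable_indic.
  exists 1 => q _; rewrite indicE ger0_norm//.
  by case: (q \in A i).
pose x j := integ (fun t => phi t * \1_(A (lshift n j)) t).
pose y j := integ (fun t => phi t * \1_(A (rshift n j)) t).
pose al j := if x j == 0 then 1 else y j.
pose be j := if x j == 0 then 0 else - x j.
pose f j q := al j * \1_(A (lshift n j)) q + be j * \1_(A (rshift n j)) q.
have fsupp j q : f j q != 0 -> A (lshift n j) q \/ A (rshift n j) q.
  have [ql|ql] := pselect (A (lshift n j) q); first by left.
  have [qr|qr] := pselect (A (rshift n j) q); first by right.
  by rewrite /f !indicE !memNset// !mulr0 addr0 eqxx.
have lr j q : A (lshift n j) q -> A (rshift n j) q -> False.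
  by move=> ql qr; have /eqP := Adisj _ _ _ ql qr; rewrite eq_lrshift.
exists f; split; last first.
  move=> i j q /fsupp[qi|qi] /fsupp[qj|qj]; have /eqP := Adisj _ _ _ qi qj.
  - by rewrite eq_lshift => /eqP.
  - by rewrite eq_lrshift.
  - by rewrite eq_rlshift.
  - by rewrite eq_rshift => /eqP.
move=> j; split.
- by apply: bounded_measurableD; apply: bounded_measurableM (bA _);
    exact: bounded_measurable_cst.
- rewrite (@eq_Rintegral _ _ _ (leb3 R) _ (fun t =>
    al j * (phi t * \1_(A (lshift n j)) t) +
    be j * (phi t * \1_(A (rshift n j)) t))).
    have il := bounded_measurable_integrable mD mDoo
      (bounded_measurableM bphi (bA (lshift n j))).
    have ir := bounded_measurable_integrable mD mDoo
      (bounded_measurableM bphi (bA (rshift n j))).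
    have il' := integrableZl mD (al j) il.
    have ir' := integrableZl mD (be j) ir.
    rewrite RintegralD//; try exact: mD.
    rewrite !RintegralZl//; try exact: mD.
    rewrite -/(x j) -/(y j) /al /be; case: (eqVneq (x j) 0) => [->|_].
      by rewrite mulr0 mul0r addr0.
    by rewrite mulNr mulrC subrr.
  by move=> t _; rewrite /f; ring.
- move=> f0.
  have pos i : (forall q, A i q -> f j q != 0) -> False.
    move=> nz; have [mA Asub] := Aprop i; apply/negP; rewrite -leNgt.
    rewrite (measure_negligible mA) //; apply: negligibleS f0 => q Aq /=.
    by move=> /(_ (Asub q Aq).1)/eqP; exact/negP/nz.
  have [x0|x0] := eqVneq (x j) 0.
    apply: (pos (lshift n j)) => q ql; rewrite /f /al /be x0 eqxx.
    by rewrite mul0r addr0 indicE mem_set// mulr1 oner_eq0.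
  apply: (pos (rshift n j)) => q qr; rewrite /f /be (negbTE x0).
  rewrite !indicE (mem_set qr) memNset ?mulr0 ?add0r ?mulr1 ?oppr_eq0//.
  by move=> /lr; apply.
- move=> q /fsupp[qi|qi].
    by have [_ /(_ q qi)[]] := Aprop (lshift n j).
  by have [_ /(_ q qi)[]] := Aprop (rshift n j).
Qed.

Lemma hop_real_orthogonal mu (a : R3 -> R) q :
  integ (fun t => phi t * a t) = 0 ->
  hop u phi mu p (fun t => (a t)%:C) q = (w q * a q)%:C.
Proof.
move=> a0; apply/eqP; rewrite eq_complex Re_hop Im_hop /rank_one /= a0.
under eq_Rintegral do rewrite mulr0.
by rewrite Rintegral_cst ?mul0r ?mulr0 ?subr0 ?eqxx//; exact: mD.
Qed.

(** A test function at [q1] with support in |w - w(q1)| < 1 / (C + 1) violates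
    a lower bound with constant C, because C < (C + 1)^2. *)
Lemma hop_spectrum_range mu q1 : torus q1 ->
  spectrum (hop u phi mu p) (w q1).
Proof.
move=> tq1 [[C C0 fC] _].
have eps0 : 0 < (C + 1)^-1 by rewrite invr_gt0; lra.
have [f [fprop _]] := test_functions 1 tq1 eps0.
have [bf ortho nz supp] := fprop ord0; apply: nz.
have sf := bounded_sq_integrable mD mDoo bf.
have [M wM] := w_upper.
have bw := bounded_measurableD (bounded_symbol mw we wM)
  (bounded_measurable_cst (@torus R) (- w q1)).
have bwf := bounded_measurableM bw bf.
have swf := bounded_sq_integrable mD mDoo bwf.
apply: (integral_sqr_eq0 mD sf).
have := fC _ (L2_of_real sf); rewrite (L2_normsq_real sf).
rewrite (_ : (fun q => _) = (fun q => ((w q + - w q1) * f ord0 q)%:C));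
  last first.
  apply/funext => q; rewrite hop_real_orthogonal//.
  by rewrite -rmorphM -rmorphB /=; congr (_ +i* _); ring.
rewrite (L2_normsq_real swf) -EFinM lee_fin.
have := le_integral_sqr (k := (C + 1)^-1 ^+ 2) mD swf sf.
move=> /(_ _) H1 H2.
have {}H1 : integ (fun q => ((w q + - w q1) * f ord0 q) ^+ 2) <=
    (C + 1)^-1 ^+ 2 * integ (fun q => f ord0 q ^+ 2).
  apply: H1 => q _; have [->|/supp fq] := eqVneq (f ord0 q) 0.
    by rewrite mulr0 expr0n/= mulr0.
  rewrite exprMn ler_wpM2r ?sqr_ge0// -(real_normK (num_real (_ + _))).
  by rewrite ler_pXn2r ?nnegrE// ltW.
set I2 := integ (fun q => f ord0 q ^+ 2) in H1 H2 *.
have I20 : 0 <= I2 := integral_sqr_ge0 _ _ _.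
rewrite leNgt; apply/negP => I2pos.
have := le_trans H2 (ler_wpM2l (ltW C0) H1).
have -> : C * ((C + 1)^-1 ^+ 2 * I2) = I2 * (C / (C + 1) ^+ 2).
  by field; lra.
rewrite ler_pMr// ler_pdivlMr ?exprn_gt0 ?addr_gt0// mul1r sqrrD.
by have := sqr_ge0 C; lra.
Qed.

(** Given n spanning functions, n + 1 test functions are eigenfunctions, and
    some combination of them vanishes almost everywhere; the supports being
    disjoint, one of them then vanishes almost everywhere too. *)
Lemma flat_bottom_infinite_multiplicity mu eps : 0 < eps ->
  (forall q, torus q -> w q < u_min u p + eps -> w q = u_min u p) ->
  ~ finite_multiplicity (hop u phi mu p) (u_min u p).
Proof.
move=> eps0 flat [n [g [_ fin]]].
have [f [fprop fdisj]] := test_functions n.+1 q0_torus eps0.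
have eig j : eigenfunction (hop u phi mu p) (u_min u p) (fun q => (f j q)%:C).
  have [bf ortho nz supp] := fprop j; split.
    exact: L2_of_real (bounded_sq_integrable mD mDoo bf).
  apply: aeW => q tq; rewrite hop_real_orthogonal// rmorphM.
  have [->|/supp fq] := eqVneq (f j q) 0; first by rewrite !mulr0.
  congr (_%:C * _); apply: flat => //; rewrite u_minE.
  by have := ler_norm (w q - w q0); lra.
have /choice[c cP] j := fin _ (eig j).
have [y y0 yc] := left_kernel_vector (\matrix_(j, k) c j k).
have [j yj] : exists j, y 0 j != 0.
  apply/existsP; rewrite -negb_forall; apply: contra y0 => /forallP y0.
  by apply/eqP/rowP => j; rewrite mxE; exact/eqP.
have [_ _ nz _] := fprop j; apply: nz.
have ae_all : \forall q \ae leb3 R, forall j, torus q ->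
    (f j q)%:C = \sum_(k < n) c j k * g k q.
  exact: (@filter_forall _ _ _ _ (ae_filter_ringOfSetsType (leb3 R)) cP).
apply: (@filterS _ _ (ae_filter_ringOfSetsType (leb3 R)) _ _ _ ae_all).
move=> q fq tq; apply/eqP/negPn/negP => fjq.
have : \sum_i y 0 i * (f i q)%:C = 0.
  transitivity (\sum_k (\sum_i y 0 i * c i k) * g k q).
    under eq_bigr do rewrite (fq _ tq) mulr_sumr.
    rewrite exchange_big/=; apply: eq_bigr => k _; rewrite mulr_suml.
    by apply: eq_bigr => i _; rewrite mulrA.
  apply: big1 => k _; move/rowP/(_ k): yc; rewrite !mxE.
  by under eq_bigr do rewrite mxE; move=> ->; rewrite mul0r.
rewrite (bigD1 j)//= big1 ?addr0 => [|i ij].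
  move/eqP; rewrite mulf_eq0 (negbTE yj)/= eq_complex/= eqxx andbT.
  by rewrite (negbTE fjq).
have [->|fiq] := eqVneq (f i q) 0; first by rewrite mulr0.
by move: ij; rewrite (fdisj _ _ _ fiq fjq) eqxx.
Qed.

Lemma hop_essential_bottom mu :
  is_bottom (essential_spectrum (hop u phi mu p)) (u_min u p).
Proof.
split; last by move=> z; exact: hop_essential_ge.
split; first by rewrite u_minE; exact: hop_spectrum_range.
move=> [_ fin [eps eps0 iso]].
apply: (@flat_bottom_infinite_multiplicity mu eps) fin => //.
move=> q tq wq; apply: iso; first exact: hop_spectrum_range.
by rewrite ger0_norm; [lra|rewrite subr_ge0 we].
Qed.

(** The limit of Lambda(p, .) at u_min p exceeds 1 / mu, so does some value;
    the values near -oo are smaller, and the solution of mu * Lambda(p, z) = 1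
    lies in between. *)
Lemma hop_unique_eigenvalue mu : 0 < mu ->
  ((mu^-1)%:E < Lambda u phi p (u_min u p))%E ->
  exists z, unique_eigenvalue_below u phi mu p z.
Proof.
move=> mu0; rewrite /Lambda ltxx => mulim.
have [M eM [L0 Llo Lup]] := secularP.
have imu0 : 0 < mu^-1 by rewrite invr_gt0.
have [b be Lb] : exists2 b, b < u_min u p & mu^-1 < L b.
  apply: contrapT => noL; move: mulim; apply/negP; rewrite -leNgt.
  apply: (secular_lim_le eM L0 Lup Lambda_intE) => z ze.
  by rewrite leNgt; apply/negP => Lz; apply: noL; exists z.
have [a ae La] := secular_small eM Lup imu0.
have [z /andP[_ ze] Lz] := secular_root eM L0 Llo Lup ae be imu0 La Lb.
have muLz : mu * L z = 1 by rewrite Lz divff// gt_eqF.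
exists z; split=> //; first exact: hop_secular_eigenvalue.
move=> z' z'e /(hop_eigenvalue_secular z'e) muLz'.
exact: secular_equation_inj muLz' muLz.
Qed.

Lemma hop_eigenvalue_gt mu z a : 0 < mu -> a < u_min u p ->
  (Lambda_int u phi p a < (mu^-1)%:E)%E ->
  unique_eigenvalue_below u phi mu p z -> a < z.
Proof.
move=> mu0 ae; rewrite Lambda_intE// lte_fin => La.
move=> [ze /(hop_eigenvalue_secular ze) muLz _].
have [M eM [L0 _ Lup]] := secularP.
rewrite ltNge; apply/negP => za; have := secular_le eM L0 Lup za ae.
have -> : L z = mu^-1 by rewrite -[RHS]mulr1 -muLz mulKf// gt_eqF.
by rewrite leNgt La.
Qed.

Lemma hop_eigenvalue_decreasing mu mu' z z' : 0 < mu -> mu < mu' ->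
  unique_eigenvalue_below u phi mu p z ->
  unique_eigenvalue_below u phi mu' p z' -> z' < z.
Proof.
move=> mu0 mumu' [ze /(hop_eigenvalue_secular ze) muLz _].
move=> [z'e /(hop_eigenvalue_secular z'e) muLz' _].
have [M eM [L0 _ Lup]] := secularP.
rewrite ltNge; apply/negP => zz'; have := secular_le eM L0 Lup zz' z'e.
apply/negP; rewrite -ltNge -(ltr_pM2l (lt_trans mu0 mumu')) muLz' -muLz.
by rewrite ltr_pM2r// -(pmulr_rgt0 _ mu0) muLz.
Qed.

End Hop.

(** * The minimum of u *)

Section MinimumOfSymbol.
Context (R : realType) (u : (R * R * R) * (R * R * R) -> R).
Local Notation R3 := (R * R * R)%type.
Hypothesis u_continuous : continuous u.
Hypothesis u_periodic : torus_periodic (@e33 R) u.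
Hypothesis u_unique_min : forall p q : R3, torus p -> torus q ->
  (p, q) != 0 -> u 0 < u (p, q).

Lemma symbol_continuous p : continuous (fun q : R3 => u (p, q)).
Proof.
move=> q.
apply: (@continuous_comp _ _ _ (fun q => (p, q)) u); last exact: u_continuous.
exact: (cvg_pair (cvg_cst p) (@cvg_id _ (nbhs q))).
Qed.

Lemma symbol_min_attained p : exists2 q, torus q &
  forall t, torus t -> u (p, q) <= u (p, t).
Proof.
apply: torus_min_attained; last exact: symbol_continuous.
move=> i q; rewrite -[in RHS](u_periodic (inr i) (p, q)); congr u.
by congr pair; rewrite /= scaler0 addr0.
Qed.

Lemma u0_le p q : torus p -> torus q -> u 0 <= u (p, q).
Proof.
move=> tp tq; have [->|pq] := eqVneq (p, q) 0; first exact: lexx.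
exact/ltW/u_unique_min.
Qed.

Lemma u_infE : u_inf u = u 0.
Proof.
apply: inf_image_min => [|[p q] [tp tq]]; last exact: u0_le.
by split; exact: torus0.
Qed.

Lemma u_inf_lt_u_min p : torus p -> p != 0 -> u_inf u < u_min u p.
Proof.
move=> tp p0; have [q tq qmin] := symbol_min_attained p.
rewrite u_infE (u_minE tq qmin); apply: u_unique_min => //.
by apply: contra p0 => /eqP pq0; exact/eqP/(congr1 fst pq0).
Qed.

Lemma u_min0 : u_min u 0 = u_inf u.
Proof.
rewrite u_infE (u_minE (@torus0 R))// => q tq; exact: (u0_le (@torus0 R) tq).
Qed.

End MinimumOfSymbol.

Theorem theorem2p15 (R : realType)
  (u : (R * R * R) * (R * R * R) -> R) (phi : R * R * R -> R)
  (theta delta : R) (theta_gt : 1 / 2 < theta) (theta_lt1 : theta < 1)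
  (delta_gt0 : 0 < delta) (delta_small : delta < pi)
  (u_periodic : torus_periodic (@e33 R) u)
  (u_even : forall p q : R * R * R, u (- p, - q) = u (p, q))
  (u_unique_min : forall p q : R * R * R, torus p -> torus q ->
     (p, q) != 0 -> u 0 < u (p, q))
  (u_nondegenerate : posdef (hess u))
  (u_C3 : Ck_on (@e33 R) 3 setT u)
  (u_hoelder : forall s : seq ('I_3 + 'I_3), size s = 3%N ->
     hoelder_space (@e33 R) (@enorm33 R) theta
       (ball_torus delta `*` ball_torus delta) (pderiv (@e33 R) s u))
  (U : 'M[R]_3) (l1 l2 l : R)
  (U_posdef : posdef U) (l1_gt0 : 0 < l1) (l2_gt0 : 0 < l2) (l_neq0 : l != 0)
  (hess_pp : hess_block inl inl u = l1 *: U)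
  (hess_pq : hess_block inl inr u = l *: U)
  (hess_qq : hess_block inr inr u = l2 *: U)
  (phi_periodic : torus_periodic (@e3 R) phi)
  (phi_C2 : Ck_on (@e3 R) 2 setT phi)
  (phi_parity : (forall q : R * R * R, phi (- q) = phi q) \/
     (forall q : R * R * R, phi (- q) = - phi q))
  (hyp_a : forall p : R * R * R, torus p -> p != 0 ->
     (0 < Lambda u phi p (u_min u p) - Lambda u phi 0%R (u_min u 0%R))%E)
  (hyp_b_max : forall p : R * R * R, torus p -> p != 0 ->
     (Lambda u phi p (u_inf u) < Lambda u phi 0%R (u_inf u))%E)
  (hyp_b_quad : exists2 c : R, 0 < c &
     forall p : R * R * R, ball_torus delta p -> p != 0 ->
     ((c * enorm3 p ^+ 2)%:E <
        Lambda u phi 0%R (u_inf u) - Lambda u phi p (u_inf u))%E) :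
  let mu0 := (fine (Lambda u phi 0%R (u_inf u)))^-1 in
  exists e : R -> R * R * R -> R,
    (forall p : R * R * R, torus p -> p != 0 ->
       [/\ unique_eigenvalue_below u phi mu0 p (e mu0 p),
           is_bottom (essential_spectrum (hop u phi mu0 p)) (u_min u p),
           u_inf u < e mu0 p &
           e mu0 p < u_min u p]) /\
    (forall mu : R, mu0 < mu ->
       [/\ forall p : R * R * R, torus p ->
             unique_eigenvalue_below u phi mu p (e mu p),
           forall p : R * R * R, torus p -> p != 0 ->
             e mu p < e mu0 p /\ e mu0 p < u_min u p &
           e mu 0 < u_inf u]).
Proof.
move=> mu0.
have u_cont : continuous u by move=> x; exact: ((u_C3 [::]).2 isT x I).
have phi_cont : continuous phi by move=> x; exact: ((phi_C2 [::]).2 isT x I).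
have w_cont := symbol_continuous u_cont.
have wmin := symbol_min_attained u_cont u_periodic.
have inf_lt := u_inf_lt_u_min u_cont u_periodic u_unique_min.
have min0 := u_min0 u_unique_min.
have Lambda_inf p : torus p -> p != 0 ->
    Lambda u phi p (u_inf u) = Lambda_int u phi p (u_inf u).
  by move=> tp p0; rewrite /Lambda inf_lt.
(* a nonzero point at which to read off that Lambda(0, m) is finite *)
pose p1 : R * R * R := (pi, 0, 0).
have pi0 := pi_gt0 R.
have tp1 : torus p1.
  by split; [split|]; rewrite /= in_itv/=; apply/andP; split; lra.
have p1n0 : p1 != 0.
  by apply/eqP => -[p10]; move: pi0; rewrite p10 ltxx.
have [b b0 Lb] : exists2 b : R, 0 < b & Lambda u phi 0 (u_inf u) = b%:E.
  have := hyp_b_max p1 tp1 p1n0; rewrite Lambda_inf// => lt1.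
  have /le_lt_trans/(_ lt1) : (0 <= Lambda_int u phi p1 (u_inf u))%E.
    apply: integral_ge0 => t tt; rewrite lee_fin mulr_ge0 ?sqr_ge0//.
    have [q tq qmin] := wmin p1.
    rewrite invr_ge0 subr_ge0 (le_trans (ltW (inf_lt _ tp1 p1n0)))//.
    by rewrite (u_minE tq qmin) qmin.
  have := hyp_a p1 tp1 p1n0; rewrite min0.
  case: (Lambda u phi 0 (u_inf u)) => [b _| |//].
    by rewrite lte_fin => b0; exists b.
  by rewrite addeNy.
have mu0E : mu0 = b^-1 by rewrite /mu0 Lb.
have mu0_gt0 : 0 < mu0 by rewrite mu0E invr_gt0.
have Lambda_gt p : torus p -> p != 0 ->
    (b%:E < Lambda u phi p (u_min u p))%E.
  by move=> tp p0; have := hyp_a p tp p0; rewrite min0 Lb sube_gt0.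
pose e mu p := xget 0 [set z | unique_eigenvalue_below u phi mu p z].
have eP mu p : 0 < mu -> ((mu^-1)%:E < Lambda u phi p (u_min u p))%E ->
    unique_eigenvalue_below u phi mu p (e mu p).
  move=> mu_gt0 ltL; have [q tq qmin] := wmin p.
  have [z zP] := hop_unique_eigenvalue (w_cont p) phi_cont tq qmin mu_gt0 ltL.
  exact: (xgetPex 0 (ex_intro _ z zP)).
have e0P p : torus p -> p != 0 -> unique_eigenvalue_below u phi mu0 p (e mu0 p).
  by move=> tp p0; apply: eP => //; rewrite mu0E invrK Lambda_gt.
exists e; split=> [p tp p0|mu mu0mu].
  have [q tq qmin] := wmin p; split.
  - exact: e0P.
  - exact: (hop_essential_bottom (w_cont p) phi_cont tq qmin).
  - apply: (hop_eigenvalue_gt (w_cont p) phi_cont tq qmin mu0_gt0 _ _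
              (e0P p tp p0)).
      exact: inf_lt.
    by rewrite mu0E invrK -Lambda_inf// -Lb hyp_b_max.
  - by have [] := e0P p tp p0.
have mu_gt0 : 0 < mu := lt_trans mu0_gt0 mu0mu.
have muLt : mu^-1 < b by rewrite -[b]invrK -mu0E ltf_pV2.
have emuP p : torus p -> unique_eigenvalue_below u phi mu p (e mu p).
  move=> tp; apply: eP => //; have [->|p0] := eqVneq p 0.
    by rewrite min0 Lb lte_fin.
  by apply: lt_trans (Lambda_gt p tp p0); rewrite lte_fin.
split=> [//|p tp p0|].
  split; last by have [] := e0P p tp p0.
  have [q tq qmin] := wmin p.
  exact: (hop_eigenvalue_decreasing (w_cont p) phi_cont tq qmin mu0_gt0 mu0mu
            (e0P p tp p0) (emuP p tp)).
by rewrite -min0; have [] := emuP 0 (@torus0 R).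
Qed.
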